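(* Let $\mathbb K$ be a triangulation (finite or infinite, with or without boundary) of a disc in $\mathbb C$, let $\mathcal P$ be a univalent circle packing for $\mathbb K$, and let $(\mathbb K,p_{\mathcal P})$ be the random walk on $\mathbb K^1$ induced by $\mathcal P$. For $v\in\mathbb K^0$ let $S_{\mathcal P}(v)\in\mathbb C$ be the center of the circle $C_{\mathcal P}(v)$ of $\mathcal P$ corresponding to $v$, and define $\Re_{\mathcal P},\Im_{\mathcal P}:\mathbb K^0\to\mathbb R$ by $\Re_{\mathcal P}(v):=\mathrm{Re}(S_{\mathcal P}(v))$ and $\Im_{\mathcal P}(v):=\mathrm{Im}(S_{\mathcal P}(v))$. Then $\Re_{\mathcal P}$ and $\Im_{\mathcal P}$ are harmonic for $(\mathbb K,p_{\mathcal P})$.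
   Context: $\mathbb K$ is a locally finite simplicial $2$-complex triangulating a disc in $\mathbb C$, oriented by the orientation of $\mathbb C$; $\mathbb K^0$ and $\mathbb K^1$ are its vertex set and edge set, $\mathrm{int}\,\mathbb K^0$ is the set of interior (non-boundary) vertices, and $u\sim v$ means $uv\in\mathbb K^1$. A univalent circle packing for $\mathbb K$ is a collection $\mathcal P=\{C_{\mathcal P}(v)\}_{v\in\mathbb K^0}$ of Euclidean circles in $\mathbb C$ (of positive finite radii $r_{\mathcal P}(v)$) whose bounded open discs are pairwise disjoint, such that $C_{\mathcal P}(u)$ and $C_{\mathcal P}(v)$ are (externally) tangent whenever $u\sim v$, and such that for every positively oriented face $(u,v,w)$ of $\mathbb K$ the centers of $C_{\mathcal P}(u),C_{\mathcal P}(v),C_{\mathcal P}(w)$ form a positively oriented triangle. Edge conductances: if $u\sim v$ and at least one of $u,v$ is an interior vertex, there are exactly two faces of $\mathbb K$ containing the edge $uv$; let $w',w''$ be their third vertices. Let $r'_{\mathcal P}(uv)$ and $r''_{\mathcal P}(uv)$ be the radii of the circles orthogonal to all three circles of the triples $C_{\mathcal P}(u),C_{\mathcal P}(v),C_{\mathcal P}(w')$ and $C_{\mathcal P}(u),C_{\mathcal P}(v),C_{\mathcal P}(w'')$, respectively. Set $$c_{\mathcal P}(u,v):=\frac{r'_{\mathcal P}(uv)+r''_{\mathcal P}(uv)}{r_{\mathcal P}(u)+r_{\mathcal P}(v)}.$$ The random walk $(\mathbb K,p_{\mathcal P})$ induced by $\mathcal P$ has transition probabilities $p_{\mathcal P}(u,v)$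 (from $u$ to $v$): if $u\in\mathrm{int}\,\mathbb K^0$, then $p_{\mathcal P}(u,v)=c_{\mathcal P}(u,v)/\sum_{w\sim u}c_{\mathcal P}(u,w)$ when $v\sim u$, and $p_{\mathcal P}(u,v)=0$ otherwise; if $u\notin\mathrm{int}\,\mathbb K^0$, then $p_{\mathcal P}(u,u)=1$ and $p_{\mathcal P}(u,v)=0$ for $v\ne u$ (the boundary is an absorbing barrier). A function $f:\mathbb K^0\to\mathbb R$ is harmonic for $(\mathbb K,p_{\mathcal P})$ if $f(v)=\sum_{u\sim v}p_{\mathcal P}(v,u)f(u)$ for every $v\in\mathrm{int}\,\mathbb K^0$. *)

(* Defs.v *)
From HB Require Import structures.
From mathcomp Require Import all_boot all_order all_algebra finmap.
From mathcomp Require Import all_classical all_reals all_analysis.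
From mathcomp Require Import complex.

Set Implicit Arguments.
Unset Strict Implicit.
Unset Printing Implicit Defensive.

Import Order.TTheory GRing.Theory Num.Theory numFieldNormedType.Exports.

Local Open Scope classical_set_scope.
Local Open Scope ring_scope.

(* [R[i]] seen as a numClosedFieldType, which is what gives it the topology of
   MathComp-Analysis; on the bare type [R[i]] that topology is not inferred. *)
Definition Cplx (R : realType) : numClosedFieldType := R[i].

(* Real-valued distance (the norm of [Cplx R] takes its values in [Cplx R]). *)
Definition cdist (R : realType) (a b : Cplx R) : R :=
  ComplexField.Normc.normc (a - b).

Definition cdot (R : realType) (a b : Cplx R) : R :=
  complex.Re a * complex.Re b + complex.Im a * complex.Im b.

(* The triangle [a b c] is nondegenerate and counterclockwise. *)
Definition positively_oriented (R : realType) (a b c : Cplx R) : Prop :=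
  0 < complex.Re (b - a) * complex.Im (c - a)
      - complex.Im (b - a) * complex.Re (c - a).

Definition homeomorphic (T U : topologicalType) (A : set T) (B : set U) : Prop :=
  exists (f : T -> U) (g : U -> T),
    [/\ {within A, continuous f}, {within B, continuous g},
        forall x, A x -> B (f x) /\ g (f x) = x &
        forall y, B y -> A (g y) /\ f (g y) = y].

(* A disc is a copy of the open unit disc together with an arbitrary part of
   the unit circle: all of it (compact disc), none of it (disc without
   boundary), or some of it (noncompact disc with boundary). *)
Definition topological_disc (R : realType) (D : set (Cplx R)) : Prop :=
  exists E : set (Cplx R),
    [/\ [set z | cdist z 0 < 1] `<=` E, E `<=` [set z | cdist z 0 <= 1] &
        homeomorphic D E].

(* A geometric simplicial complex in the plane with vertex set the whole type
   [V]; a simplex is given by its set of vertices. *)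
Record planar_complex (R : realType) (V : choiceType) := PlanarComplex {
  simplex : set {fset V};
  position : V -> Cplx R
}.

Definition hull (R : realType) (V : choiceType) (K : planar_complex R V)
    (s : {fset V}) : set (Cplx R) :=
  [set z | exists t : V -> R,
    [/\ forall v, v \in s -> 0 <= t v, \sum_(v <- s) t v = 1 &
        z = \sum_(v <- s) (t v)%:C%C * position K v]].

Definition carrier (R : realType) (V : choiceType) (K : planar_complex R V) :
    set (Cplx R) :=
  [set z | exists2 s, simplex K s & hull K s z].

Definition affinely_independent (R : realType) (V : choiceType)
    (K : planar_complex R V) (s : {fset V}) : Prop :=
  forall t : V -> R,
    \sum_(v <- s) t v = 0 ->
    \sum_(v <- s) (t v)%:C%C * position K v = 0 ->
    forall v, v \in s -> t v = 0.

(* In [simplicial_meet], [s `&` t] may be empty; its hull is then empty. *)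
Record simplicial_2_complex (R : realType) (V : choiceType)
    (K : planar_complex R V) : Prop := {
  simplicial_dim : forall s, simplex K s -> (0 < #|` s| <= 3)%N;
  simplicial_vertex : forall v, simplex K [fset v]%fset;
  simplicial_sub : forall s t,
    simplex K s -> (t `<=` s)%fset -> t != fset0 -> simplex K t;
  simplicial_affine : forall s, simplex K s -> affinely_independent K s;
  simplicial_meet : forall s t, simplex K s -> simplex K t ->
    hull K s `&` hull K t = hull K (s `&` t)%fset
}.

Definition locally_finite_complex (R : realType) (V : choiceType)
    (K : planar_complex R V) : Prop :=
  forall z, carrier K z -> exists2 U, nbhs z U &
    finite_set [set s | simplex K s /\ hull K s `&` U !=set0].

Definition disc_triangulation (R : realType) (V : choiceType)
    (K : planar_complex R V) : Prop :=
  [/\ simplicial_2_complex K, locally_finite_complex K &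
      topological_disc (carrier K)].

Definition adjacent (R : realType) (V : choiceType) (K : planar_complex R V)
    (u v : V) : Prop :=
  u != v /\ simplex K [fset u; v]%fset.

Definition face (R : realType) (V : choiceType) (K : planar_complex R V)
    (u v w : V) : Prop :=
  uniq [:: u; v; w] /\ simplex K [fset u; v; w]%fset.

Definition positive_face (R : realType) (V : choiceType)
    (K : planar_complex R V) (u v w : V) : Prop :=
  face K u v w /\
  positively_oriented (position K u) (position K v) (position K w).

Definition interior_vertex (R : realType) (V : choiceType)
    (K : planar_complex R V) (v : V) : Prop :=
  (carrier K)^° (position K v).

Record circle (R : realType) := Circle {
  center : Cplx R;
  radius : R;
  radius_gt0 : 0 < radius
}.

Definition on_circle (R : realType) (C : circle R) : set (Cplx R) :=
  [set z | cdist z (center C) = radius C].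

Definition open_disc (R : realType) (C : circle R) : set (Cplx R) :=
  [set z | cdist z (center C) < radius C].

Definition externally_tangent (R : realType) (C D : circle R) : Prop :=
  (exists z, on_circle C `&` on_circle D = [set z]) /\
  open_disc C `&` open_disc D = set0.

(* At a common point the two radii, hence the two tangent lines, are
   perpendicular; by symmetry the angle is the same at both common points. *)
Definition orthogonal_circles (R : realType) (C D : circle R) : Prop :=
  exists z, [/\ on_circle C z, on_circle D z &
                cdot (z - center C) (z - center D) = 0].

Definition univalent_packing (R : realType) (V : choiceType)
    (K : planar_complex R V) (P : V -> circle R) : Prop :=
  [/\ forall u v, u != v -> open_disc (P u) `&` open_disc (P v) = set0,
      forall u v, adjacent K u v -> externally_tangent (P u) (P v) &
      forall u v w, positive_face K u v w ->
        positively_oriented (center (P u)) (center (P v)) (center (P w))].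

(* The radius of the circle orthogonal to [C1], [C2] and [C3]. *)
Definition orthogonal_radius (R : realType) (C1 C2 C3 : circle R) : R :=
  xget 0 [set rho | exists C : circle R,
    [/\ radius C = rho, orthogonal_circles C C1, orthogonal_circles C C2 &
        orthogonal_circles C C3]].

(* The sum runs over the third vertices [w', w''] of the faces containing the
   edge [uv]. *)
Definition conductance (R : realType) (V : choiceType) (K : planar_complex R V)
    (P : V -> circle R) (u v : V) : R :=
  (\sum_(w \in [set w | face K u v w]) orthogonal_radius (P u) (P v) (P w))
    / (radius (P u) + radius (P v)).

Definition transition (R : realType) (V : choiceType) (K : planar_complex R V)
    (P : V -> circle R) (u v : V) : R :=
  if `[< interior_vertex K u >] then
    if `[< adjacent K u v >] then
      conductance K P u v
        / \sum_(w \in [set w | adjacent K u w]) conductance K P u w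
    else 0
  else if v == u then 1 else 0.

Definition harmonic_function (R : realType) (V : choiceType) (K : planar_complex R V)
    (p : V -> V -> R) (f : V -> R) : Prop :=
  forall v, interior_vertex K v ->
    f v = \sum_(u \in [set u | adjacent K v u]) p v u * f u.

(* Main.v *)
From mathcomp Require Import all_boot all_order all_algebra finmap.
From mathcomp Require Import all_classical all_reals all_analysis.
From mathcomp Require Import ring lra.
Require Import Defs.
From mathcomp Require Import complex.

Set Implicit Arguments.
Unset Strict Implicit.
Unset Printing Implicit Defensive.

Import Order.TTheory GRing.Theory Num.Theory numFieldNormedType.Exports.

Local Open Scope classical_set_scope.
Local Open Scope ring_scope.

Local Notation Re := complex.Re.
Local Notation Im := complex.Im.

(** Write [S(v)] and [r(v)] for the centre and the radius of the circle of [v].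
Up to a positive factor, the mean of [S] under one step of the walk from an
interior vertex [v] exceeds [S(v)] by

  sum over u ~ v, and over the faces vuw containing vu, of  rho(vuw) * e(u),

where [rho(vuw)] is the radius of the circle orthogonal to the three circles
of the face and [e(u)] is the unit vector from [S(v)] to [S(u)]: the
conductance of [vu] has [r(v) + r(u) = |S(u) - S(v)|] as denominator.
So each face around [v] contributes [rho(vuw) * (e(u) + e(w))].

The circle orthogonal to three mutually tangent circles is the incircle of the
triangle of centres ([orthogonal_radiusE]).  It touches the sides at [v] at
the points [S(v) + r(v) e(u)] and [S(v) + r(v) e(w)], and its centre is
[S(v) + r(v) e(u) + i rho e(u) = S(v) + r(v) e(w) - i rho e(w)] when [vuw] is
positively oriented.  Hence [rho (e(u) + e(w)) = - i r(v) (e(w) - e(u))]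
([inradius_balance]), and the sum over the faces telescopes around [v]
([cyclic_telescope]), provided that each edge [vu] has exactly one face on its
left and one on its right ([side_faces_exist], [left_face_unique],
[right_face_unique]).

The latter holds because [v] is interior.  A parabola leaving [v] tangentially
to [vu], bent to one side, stays in the carrier for a short time; by local
finiteness some simplex of the complex contains points of it arbitrarily close
to [v].  A parabola has at most two points on a line, so this simplex is a
triangle; in the three inequalities that define it the parabola gives
quadratic polynomials in time, whose low order coefficients show that the
triangle contains the beginning of the edge [vu] ([interior_germ]).  Being a
simplex of the same complex it has [vu] as an edge, and it lies on the side
towards which the parabola is bent.  Uniqueness holds because two triangles on
the same side of a common edge overlap near its midpoint. *)

(** * Tangent and orthogonal circles *)

Definition sqdist (R : realType) (a b : Cplx R) : R :=
  (Re a - Re b) ^+ 2 + (Im a - Im b) ^+ 2.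

Definition cross (R : realType) (a b : Cplx R) : R := Re a * Im b - Im a * Re b.

(** Twice the signed area of the triangle [a b c]. *)
Definition orient (R : realType) (a b c : Cplx R) : R := cross (b - a) (c - a).

Lemma cdistE (R : realType) (a b : Cplx R) : cdist a b = Num.sqrt (sqdist a b).
Proof. by case: a b => [a1 a2] [b1 b2]. Qed.

Lemma cdist_ge0 (R : realType) (a b : Cplx R) : 0 <= cdist a b.
Proof. by rewrite cdistE sqrtr_ge0. Qed.

Lemma sqr_cdist (R : realType) (a b : Cplx R) : cdist a b ^+ 2 = sqdist a b.
Proof. by rewrite cdistE sqr_sqrtr // addr_ge0 ?sqr_ge0. Qed.

Lemma cdist_eq (R : realType) (a b : Cplx R) (r : R) : 0 <= r ->
  (cdist a b = r) <-> (sqdist a b = r ^+ 2).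
Proof.
move=> r0; rewrite -sqr_cdist; split=> [-> //|].
by move=> /eqP; rewrite eqrXn2 ?cdist_ge0 // => /eqP.
Qed.

Lemma cdist_lt (R : realType) (a b : Cplx R) (r : R) : 0 <= r ->
  (cdist a b < r) = (sqdist a b < r ^+ 2).
Proof. by move=> r0; rewrite -sqr_cdist ltr_pXn2r ?nnegrE ?cdist_ge0. Qed.

Lemma cdistC (R : realType) (a b : Cplx R) : cdist a b = cdist b a.
Proof. by rewrite !cdistE; congr Num.sqrt; rewrite /sqdist; ring. Qed.

Lemma cdist_triangle (R : realType) (a b c : Cplx R) :
  cdist a c <= cdist a b + cdist b c.
Proof.
rewrite /cdist.
have -> : a - c = (a - b) + (b - c) by rewrite addrA subrK.
exact: le_normcD.
Qed.

(** A common point gives one inequality by the triangle inequality, and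
disjointness of the discs gives the other. *)
Lemma tangent_sqdist (R : realType) (C D : circle R) :
  externally_tangent C D ->
  sqdist (center C) (center D) = (radius C + radius D) ^+ 2.
Proof.
case: C D => [c r r0] [d s s0] [/= zCD disj].
have rs0 : 0 < r + s by exact: addr_gt0.
apply/(cdist_eq _ _ (ltW rs0))/eqP; rewrite eq_le; apply/andP; split.
  have [z {}zCD] := zCD.
  have [zC zD] : (on_circle (Circle c r0) `&` on_circle (Circle d s0)) z.
    by rewrite zCD.
  rewrite (le_trans (cdist_triangle _ z _)) // cdistC.
  by rewrite (zC : cdist z c = r) (zD : cdist z d = s).
rewrite leNgt; apply/negP => lt_cd.
(* the point dividing [c, d] in the ratio r : s would lie in both discs *)
pose z : Cplx R :=
  ((s * Re c + r * Re d) / (r + s) +i* ((s * Im c + r * Im d) / (r + s)))%C.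
suff : @classical_sets.set0 (Cplx R) z by [].
rewrite -disj; split; rewrite /open_disc /= cdist_lt ?ltW //.
  have -> : sqdist z c = (r / (r + s)) ^+ 2 * sqdist c d.
    by rewrite /sqdist /=; field; exact: lt0r_neq0.
  rewrite cdist_lt ?ltW // in lt_cd.
  have -> : r ^+ 2 = (r / (r + s)) ^+ 2 * (r + s) ^+ 2.
    by rewrite -exprMn divfK // lt0r_neq0.
  by rewrite ltr_pM2l // exprn_gt0 // divr_gt0.
have -> : sqdist z d = (s / (r + s)) ^+ 2 * sqdist c d.
  by rewrite /sqdist /=; field; exact: lt0r_neq0.
rewrite cdist_lt ?ltW // in lt_cd.
have -> : s ^+ 2 = (s / (r + s)) ^+ 2 * (r + s) ^+ 2.
  by rewrite -exprMn divfK // lt0r_neq0.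
by rewrite ltr_pM2l // exprn_gt0 // divr_gt0.
Qed.

Lemma orthogonal_sqdist (R : realType) (C D : circle R) :
  orthogonal_circles C D ->
  sqdist (center C) (center D) = radius C ^+ 2 + radius D ^+ 2.
Proof.
case: C D => [[c1 c2] r r0] [[d1 d2] s s0] [[z1 z2]] [].
rewrite /on_circle /= !cdist_eq ?ltW // => <- <-.
rewrite /cdot /sqdist /= => h; rewrite -[RHS]subr0 -(mulr0 2) -h; ring.
Qed.

(** The power of [c] with respect to each of the three circles is the squared
radius.  Differences of these equations are linear in [c] with determinant
[orient], so [c] is unique, and then so is the radius. *)
Lemma orthogonal_radius_unique (R : realType) (C1 C2 C3 C D : circle R) :
  orient (center C1) (center C2) (center C3) != 0 ->
  orthogonal_circles C C1 -> orthogonal_circles C C2 ->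
  orthogonal_circles C C3 ->
  orthogonal_circles D C1 -> orthogonal_circles D C2 ->
  orthogonal_circles D C3 -> radius C = radius D.
Proof.
move=> nz /orthogonal_sqdist h1 /orthogonal_sqdist h2 /orthogonal_sqdist h3.
move=> /orthogonal_sqdist k1 /orthogonal_sqdist k2 /orthogonal_sqdist k3.
have C0 := radius_gt0 C; have D0 := radius_gt0 D.
case: C C0 h1 h2 h3 => [[p1 p2] r ?] /= r0.
case: D D0 k1 k2 k3 => [[q1 q2] s ?] /= s0.
case: C1 nz => [[x1 y1] r1 ?]; case: C2 => [[x2 y2] r2 ?].
case: C3 => [[x3 y3] r3 ?]; rewrite /orient /cross /sqdist /= => nz.
move=> k1 k2 k3 h1 h2 h3.
have e2 : (p1 - q1) * (x2 - x1) + (p2 - q2) * (y2 - y1) = 0 by lra.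
have e3 : (p1 - q1) * (x3 - x1) + (p2 - q2) * (y3 - y1) = 0 by lra.
have d1 : p1 = q1.
  apply/eqP; rewrite -subr_eq0 -(mulIr_eq0 _ (mulIf nz)); apply/eqP.
  have -> : (p1 - q1) * ((x2 - x1) * (y3 - y1) - (y2 - y1) * (x3 - x1)) =
    ((p1 - q1) * (x2 - x1) + (p2 - q2) * (y2 - y1)) * (y3 - y1)
    - ((p1 - q1) * (x3 - x1) + (p2 - q2) * (y3 - y1)) * (y2 - y1) by ring.
  by rewrite e2 e3; ring.
have d2 : p2 = q2.
  apply/eqP; rewrite -subr_eq0 -(mulIr_eq0 _ (mulIf nz)); apply/eqP.
  have -> : (p2 - q2) * ((x2 - x1) * (y3 - y1) - (y2 - y1) * (x3 - x1)) =
    ((p1 - q1) * (x3 - x1) + (p2 - q2) * (y3 - y1)) * (x2 - x1)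
    - ((p1 - q1) * (x2 - x1) + (p2 - q2) * (y2 - y1)) * (x3 - x1) by ring.
  by rewrite e2 e3; ring.
apply/eqP; rewrite -(@eqrXn2 _ 2%N) ?ltW //; apply/eqP; subst; lra.
Qed.

(** The side opposite to the centre of [C1] has length
[radius C2 + radius C3]; side lengths are the barycentric weights of the
incentre. *)
Definition incenter (R : realType) (C1 C2 C3 : circle R) : Cplx R :=
  let s := 2 * (radius C1 + radius C2 + radius C3) in
  let bary f := ((radius C2 + radius C3) * f (center C1)
    + (radius C1 + radius C3) * f (center C2)
    + (radius C1 + radius C2) * f (center C3)) / s in
  (bary (@Re R) +i* bary (@Im R))%C.

(** Area divided by half the perimeter.  Unlike the formula with a square root,
this one is rational, and visibly positive for a positive triangle. *)
Definition inradius (R : realType) (C1 C2 C3 : circle R) : R :=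
  orient (center C1) (center C2) (center C3)
  / (2 * (radius C1 + radius C2 + radius C3)).

(** The metric consequence of tangency is all that the computations need; in
this form it is invariant under rotation of the three circles. *)
Definition mutually_tangent (R : realType) (C1 C2 C3 : circle R) : Prop :=
  [/\ sqdist (center C1) (center C2) = (radius C1 + radius C2) ^+ 2,
      sqdist (center C1) (center C3) = (radius C1 + radius C3) ^+ 2 &
      sqdist (center C2) (center C3) = (radius C2 + radius C3) ^+ 2].

Lemma mutually_tangent_rot (R : realType) (C1 C2 C3 : circle R) :
  mutually_tangent C1 C2 C3 -> mutually_tangent C2 C3 C1.
Proof. by rewrite /mutually_tangent /sqdist => -[h1 h2 h3]; split; lra. Qed.

Lemma orient_rot (R : realType) (a b c : Cplx R) : orient b c a = orient a b c.
Proof.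
by case: a b c => [a1 a2] [b1 b2] [c1 c2]; rewrite /orient /cross /=; ring.
Qed.

Lemma incenter_rot (R : realType) (C1 C2 C3 : circle R) :
  incenter C2 C3 C1 = incenter C1 C2 C3.
Proof. by rewrite /incenter /=; congr (_ / _ +i* (_ / _))%C; ring. Qed.

Lemma inradius_rot (R : realType) (C1 C2 C3 : circle R) :
  inradius C2 C3 C1 = inradius C1 C2 C3.
Proof. by rewrite /inradius orient_rot; congr (_ / _); ring. Qed.

Lemma inradius_gt0 (R : realType) (C1 C2 C3 : circle R) :
  positively_oriented (center C1) (center C2) (center C3) ->
  0 < inradius C1 C2 C3.
Proof.
by move=> pos; rewrite /inradius divr_gt0 // mulr_gt0 // !addr_gt0 ?radius_gt0.
Qed.

(** The law of cosines for the sides [p + q], [p + r] and [q + r]. *)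
Lemma dot_of_tangent (R : realType) (a1 a2 b1 b2 p q r : R) :
  a1 ^+ 2 + a2 ^+ 2 = (p + q) ^+ 2 -> b1 ^+ 2 + b2 ^+ 2 = (p + r) ^+ 2 ->
  (a1 - b1) ^+ 2 + (a2 - b2) ^+ 2 = (q + r) ^+ 2 ->
  a1 * b1 + a2 * b2 = p ^+ 2 + p * q + p * r - q * r.
Proof. by move=> ? ? ?; lra. Qed.

Lemma incircle_orthogonal (R : realType) (C1 C2 C3 C : circle R) :
  mutually_tangent C1 C2 C3 -> center C = incenter C1 C2 C3 ->
  radius C = inradius C1 C2 C3 -> orthogonal_circles C C1.
Proof.
move=> [h12 h13 h23] cC rC; have p0 := radius_gt0 C1; have q0 := radius_gt0 C2.
have r0 := radius_gt0 C3; have rC0 := ltW (radius_gt0 C).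
(* the incircle touches the side C1 C2 at the tangency point of C1 and C2 *)
pose z : Cplx R :=
  ((radius C2 * Re (center C1) + radius C1 * Re (center C2))
     / (radius C1 + radius C2)
   +i* ((radius C2 * Im (center C1) + radius C1 * Im (center C2))
     / (radius C1 + radius C2)))%C.
suff [zC z1 perp] : [/\ sqdist z (center C) = radius C ^+ 2,
    sqdist z (center C1) = radius C1 ^+ 2 &
    cdot (z - center C) (z - center C1) = 0].
  by exists z; split=> //; apply/cdist_eq => //; exact: ltW.
rewrite {}/z cC rC /inradius /incenter.
case: C1 h12 h13 p0 {cC rC rC0} => [[x1 y1] p ?] /=.
case: C2 h23 q0 => [[x2 y2] q ?] /=; case: C3 r0 => [[x3 y3] r ?] /=.
rewrite /sqdist /orient /cross /cdot /= => r0 h23 q0 h12 h13 p0.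
have pq : p + q != 0 by rewrite lt0r_neq0 ?addr_gt0.
have s0 : p + q + r != 0 by rewrite lt0r_neq0 ?addr_gt0.
set a1 := x2 - x1; set a2 := y2 - y1; set b1 := x3 - x1; set b2 := y3 - y1.
have hA : a1 ^+ 2 + a2 ^+ 2 = (p + q) ^+ 2 by rewrite -h12 /a1 /a2; ring.
have hB : b1 ^+ 2 + b2 ^+ 2 = (p + r) ^+ 2 by rewrite -h13 /b1 /b2; ring.
have hD : a1 * b1 + a2 * b2 = p ^+ 2 + p * q + p * r - q * r.
  by apply: dot_of_tangent => //; rewrite -h23 /a1 /a2 /b1 /b2; ring.
have hX : (a1 * b2 - a2 * b1) ^+ 2 =
    (a1 ^+ 2 + a2 ^+ 2) * (b1 ^+ 2 + b2 ^+ 2) - (a1 * b1 + a2 * b2) ^+ 2.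
  by ring.
pose t := p / (p + q).
pose al := (p + r) / (2 * (p + q + r)); pose be := (p + q) / (2 * (p + q + r)).
have ex : (q * x1 + p * x2) / (p + q) = x1 + t * a1 by rewrite /t /a1; field.
have ey : (q * y1 + p * y2) / (p + q) = y1 + t * a2 by rewrite /t /a2; field.
have fx : ((q + r) * x1 + (p + r) * x2 + (p + q) * x3) / (2 * (p + q + r)) =
  x1 + al * a1 + be * b1 by rewrite /al /be /a1 /b1; field.
have fy : ((q + r) * y1 + (p + r) * y2 + (p + q) * y3) / (2 * (p + q + r)) =
  y1 + al * a2 + be * b2 by rewrite /al /be /a2 /b2; field.
rewrite ex ey fx fy expr_div_n hX hA hB hD; split.
- transitivity ((t - al) ^+ 2 * (a1 ^+ 2 + a2 ^+ 2)
    + be ^+ 2 * (b1 ^+ 2 + b2 ^+ 2) - 2 * (t - al) * be * (a1 * b1 + a2 * b2)).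
    by ring.
  by rewrite hA hB hD /t /al /be; field; rewrite ?pq ?s0.
- transitivity (t ^+ 2 * (a1 ^+ 2 + a2 ^+ 2)); first by ring.
  by rewrite hA /t; field.
- transitivity
    (t * (t - al) * (a1 ^+ 2 + a2 ^+ 2) - t * be * (a1 * b1 + a2 * b2)).
    by ring.
  by rewrite hA hD /t /al /be; field; rewrite ?pq ?s0.
Qed.

Lemma orthogonal_radiusE (R : realType) (C1 C2 C3 : circle R) :
  mutually_tangent C1 C2 C3 ->
  positively_oriented (center C1) (center C2) (center C3) ->
  orthogonal_radius C1 C2 C3 = inradius C1 C2 C3.
Proof.
move=> tg pos; have rho0 := inradius_gt0 pos.
pose C := Circle (incenter C1 C2 C3) rho0.
have o1 : orthogonal_circles C C1 by exact: incircle_orthogonal tg _ _.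
have o2 : orthogonal_circles C C2.
  apply: incircle_orthogonal (mutually_tangent_rot tg) _ _.
    by rewrite [RHS]incenter_rot.
  by rewrite [RHS]inradius_rot.
have o3 : orthogonal_circles C C3.
  have tg' := mutually_tangent_rot (mutually_tangent_rot tg).
  apply: incircle_orthogonal tg' _ _.
    by rewrite 2![RHS]incenter_rot.
  by rewrite 2![RHS]inradius_rot.
apply: xget_unique; first by exists C.
move=> _ [D [<- d1 d2 d3]].
by apply: (orthogonal_radius_unique _ d1 d2 d3 o1 o2 o3); exact: lt0r_neq0.
Qed.

Lemma orthogonal_radiusC (R : realType) (C1 C2 C3 : circle R) :
  orthogonal_radius C1 C2 C3 = orthogonal_radius C1 C3 C2.
Proof.
by congr xget; apply/seteqP; split=> rho /= [C []]; exists C.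
Qed.

(** Real and imaginary parts of [rho (e2 + e3) = - i r1 (e3 - e2)], where [e2]
and [e3] are the unit vectors from [c1] to [c2] and [c3].  Both express that
the incentre is reached from either tangency point by a perpendicular of length
[rho]. *)
Lemma inradius_balance (R : realType) (C1 C2 C3 : circle R) (c1 := center C1)
    (c2 := center C2) (c3 := center C3) (r1 := radius C1) (r2 := radius C2)
    (r3 := radius C3) :
  mutually_tangent C1 C2 C3 ->
  inradius C1 C2 C3 *
      ((Re c2 - Re c1) / (r1 + r2) + (Re c3 - Re c1) / (r1 + r3))
    = r1 * ((Im c3 - Im c1) / (r1 + r3) - (Im c2 - Im c1) / (r1 + r2)) /\
  inradius C1 C2 C3 *
      ((Im c2 - Im c1) / (r1 + r2) + (Im c3 - Im c1) / (r1 + r3))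
    = - r1 * ((Re c3 - Re c1) / (r1 + r3) - (Re c2 - Re c1) / (r1 + r2)).
Proof.
rewrite {}/c1 {}/c2 {}/c3 {}/r1 {}/r2 {}/r3 => -[h12 h13 h23].
have p0 := radius_gt0 C1; have q0 := radius_gt0 C2; have r0 := radius_gt0 C3.
rewrite /inradius; case: C1 h12 h13 p0 => [[x1 y1] p ?] /=.
case: C2 h23 q0 => [[x2 y2] q ?] /=; case: C3 r0 => [[x3 y3] r ?] /=.
rewrite /sqdist /orient /cross /= => r0 h23 q0 h12 h13 p0.
have pq : p + q != 0 by rewrite lt0r_neq0 ?addr_gt0.
have pr : p + r != 0 by rewrite lt0r_neq0 ?addr_gt0.
have s0 : p + q + r != 0 by rewrite lt0r_neq0 ?addr_gt0.
set a1 := x2 - x1; set a2 := y2 - y1; set b1 := x3 - x1; set b2 := y3 - y1.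
have hA : a1 ^+ 2 + a2 ^+ 2 = (p + q) ^+ 2 by rewrite -h12 /a1 /a2; ring.
have hB : b1 ^+ 2 + b2 ^+ 2 = (p + r) ^+ 2 by rewrite -h13 /b1 /b2; ring.
have hD : a1 * b1 + a2 * b2 = p ^+ 2 + p * q + p * r - q * r.
  by apply: dot_of_tangent => //; rewrite -h23 /a1 /a2 /b1 /b2; ring.
set X := a1 * b2 - a2 * b1.
(* X times a side is a combination of the quarter turns of both sides, with
   inner products as coefficients *)
have Xa1 : X * a1 = b2 * (a1 ^+ 2 + a2 ^+ 2) - a2 * (a1 * b1 + a2 * b2).
  by rewrite /X; ring.
have Xb1 : X * b1 = b2 * (a1 * b1 + a2 * b2) - a2 * (b1 ^+ 2 + b2 ^+ 2).
  by rewrite /X; ring.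
have Xa2 : X * a2 = a1 * (a1 * b1 + a2 * b2) - b1 * (a1 ^+ 2 + a2 ^+ 2).
  by rewrite /X; ring.
have Xb2 : X * b2 = a1 * (b1 ^+ 2 + b2 ^+ 2) - b1 * (a1 * b1 + a2 * b2).
  by rewrite /X; ring.
have E u v : X / (2 * (p + q + r)) * (u / (p + q) + v / (p + r)) =
    (X * u / (p + q) + X * v / (p + r)) / (2 * (p + q + r)).
  by field; rewrite ?pq ?pr ?s0.
rewrite !E Xa1 Xa2 Xb1 Xb2 hA hB hD.
by split; field; rewrite ?pq ?pr ?s0.
Qed.

(** * Hulls and germs of polynomials *)

Lemma big_fset2 (R : nmodType) (V : choiceType) (a b : V) (F : V -> R) :
  a != b -> \sum_(x <- [fset a; b]%fset) F x = F a + F b.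
Proof.
move=> ab; rewrite -[in RHS](big_seq_fset1 +%R b F).
by apply: big_fsetU1; rewrite inE.
Qed.

Lemma big_fset3 (R : nmodType) (V : choiceType) (a b c : V) (F : V -> R) :
  uniq [:: a; b; c] ->
  \sum_(x <- [fset a; b; c]%fset) F x = F a + F b + F c.
Proof.
rewrite /= !inE negb_or !andbT => /andP[/andP[ab ac] bc].
rewrite addrC -(big_fset2 F ab) fsetUC.
by apply: big_fsetU1; rewrite !inE negb_or eq_sym ac eq_sym.
Qed.

Lemma hull_fset0 (R : realType) (V : choiceType) (K : planar_complex R V) z :
  ~ hull K fset0 z.
Proof.
by move=> [t [_ /eqP]]; rewrite big_seq_fset0 eq_sym oner_eq0.
Qed.

Lemma hull_fset1 (R : realType) (V : choiceType) (K : planar_complex R V) a z :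
  hull K [fset a]%fset z <-> z = position K a.
Proof.
split=> [[t [_]]|->]; first by rewrite !big_seq_fset1 => -> ->; rewrite mul1r.
by exists (fun=> 1); rewrite !big_seq_fset1 mul1r.
Qed.

Lemma hull_fset2 (R : realType) (V : choiceType) (K : planar_complex R V)
    a b z :
  hull K [fset a; b]%fset z ->
  exists2 m : R, 0 <= m <= 1 &
    z = position K a + m%:C%C * (position K b - position K a).
Proof.
have [->|ab] := eqVneq a b.
  rewrite fsetUid => /hull_fset1 ->; exists 0; first by rewrite lexx ler01.
  by rewrite mul0r addr0.
move=> [t [t0]]; rewrite !big_fset2 // => t1 ->.
have ta : 0 <= t a by apply: t0; rewrite !inE eqxx.
have tb : 0 <= t b by apply: t0; rewrite !inE eqxx orbT.
exists (t b); first by rewrite tb -t1 lerDr.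
have -> : t a = 1 - t b by rewrite -t1 addrK.
by rewrite rmorphB rmorph1; ring.
Qed.

(** The three orientations are the barycentric coordinates of [z], up to the
common factor [orient A B C]. *)
Lemma hull_fset3 (R : realType) (V : choiceType) (K : planar_complex R V)
    a b c z (A := position K a) (B := position K b) (C := position K c) :
  uniq [:: a; b; c] -> positively_oriented A B C ->
  hull K [fset a; b; c]%fset z <->
  [/\ 0 <= orient A B z, 0 <= orient B C z & 0 <= orient C A z].
Proof.
rewrite {}/A {}/B {}/C => abc pos; split.
  move=> [t [t0]]; rewrite !big_fset3 // => t1 ->.
  have ta : 0 <= t a by apply: t0; rewrite !inE eqxx.
  have tb : 0 <= t b by apply: t0; rewrite !inE eqxx orbT.
  have tc : 0 <= t c by apply: t0; rewrite !inE eqxx orbT.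
  have ea : t a = 1 - t b - t c by rewrite -t1; ring.
  move: (mulr_ge0 tc (ltW pos)).
  move: pos (mulr_ge0 ta (ltW pos)) (mulr_ge0 tb (ltW pos)).
  rewrite ea /positively_oriented /orient /cross.
  case: (position K a) => [a1 a2]; case: (position K b) => [b1 b2].
  by case: (position K c) => [c1 c2] /= _ ha hb hc; split; lra.
move=> [hab hbc hca].
set D := orient (position K a) (position K b) (position K c).
have D0 : 0 < D by [].
have [ab ac bc] : [/\ (b == a) = false, (c == a) = false & (c == b) = false].
  move: abc; rewrite /= !inE negb_or !andbT => /andP[/andP[ab ac] bc].
  by split; rewrite eq_sym; exact: negPf.
exists (fun x => if x == a then orient (position K b) (position K c) z / D else
  if x == b then orient (position K c) (position K a) z / D else
  orient (position K a) (position K b) z / D).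
rewrite !big_fset3 // !eqxx ab ac bc; split.
- by move=> v _; do 2?case: ifP => _; rewrite divr_ge0 // ltW.
- move: D0; rewrite -!mulrDl => D0.
  rewrite (_ : _ + _ + _ = D) ?divff ?lt0r_neq0 //.
  rewrite /D /orient /cross; case: (position K a) => [a1 a2].
  case: (position K b) => [b1 b2]; case: (position K c) => [c1 c2].
  by case: z {hab hbc hca} => [z1 z2] /=; ring.
- have {}D0 := lt0r_neq0 D0; move: D0; rewrite {pos} /D /orient /cross.
  case: (position K a) => [a1 a2]; case: (position K b) => [b1 b2].
  case: (position K c) => [c1 c2]; case: z {hab hbc hca} => [z1 z2] /= D0.
  by congr (_ +i* _)%C; field.
Qed.

Lemma affine_germ (R : realType) (c0 c1 : R) : 0 < c0 ->
  exists2 e, 0 < e & forall t, 0 <= t < e -> 0 <= c0 + c1 * t.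
Proof.
move=> c0_gt0; have c1' := normr_ge0 c1.
exists (c0 / (`|c1| + 1)); first by rewrite divr_gt0 //; lra.
move=> t /andP[t0]; rewrite ltr_pdivlMr; last lra.
have : - c1 * t <= `|c1| * t by rewrite ler_wpM2r // -normrN ler_norm.
by lra.
Qed.

(** If [c0 > 0] then the linear part is positive near [0]; if [c0 = 0], then a
negative [c1] would dominate the quadratic term.  So nonnegativity at times
tending to [0] passes from the quadratic polynomial to its tangent at [0]. *)
Lemma quadratic_germ (R : realType) (c0 c1 c2 : R) :
  (forall e, 0 < e -> exists2 t, 0 < t < e & 0 <= c0 + c1 * t + c2 * t ^+ 2) ->
  exists2 e, 0 < e & forall t, 0 <= t < e -> 0 <= c0 + c1 * t.
Proof.
move=> freq; have c1' := normr_ge0 c1; have c2' := normr_ge0 c2.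
have n1 := ler_norm c1; have n2 := ler_norm c2.
have [c0_lt0|c0_gt0|c00] := ltgtP c0 0.
- have [|t /andP[t0]] := freq (Num.min 1 (- c0 / (`|c1| + `|c2| + 1))).
    by rewrite lt_min ltr01 divr_gt0 //; lra.
  rewrite lt_min => /andP[t1]; rewrite ltr_pdivlMr; last lra.
  move=> ht h; exfalso.
  have h1 : c1 * t <= `|c1| * t by rewrite ler_wpM2r // ltW.
  have h2 : c2 * t ^+ 2 <= `|c2| * t ^+ 2 by rewrite ler_wpM2r // sqr_ge0.
  have h3 : `|c2| * t ^+ 2 <= `|c2| * t.
    by rewrite ler_wpM2l // expr2 ger_pMr // ltW.
  by lra.
- exact: affine_germ.
- exists 1 => // t /andP[t0 _]; rewrite c00 add0r mulr_ge0 // leNgt.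
  apply/negP => c1_lt0.
  have [|s /andP[s0]] := freq (- c1 / (`|c2| + 1)).
    by rewrite divr_gt0 //; lra.
  rewrite ltr_pdivlMr; last lra.
  rewrite c00 add0r expr2 mulrA -mulrDl pmulr_lge0 // => hs h.
  have h1 : c2 * s <= `|c2| * s by rewrite ler_wpM2r // ltW.
  by lra.
Qed.

Lemma nbhs_cdist (R : realType) (z : Cplx R) (U : set (Cplx R)) :
  nbhs z U -> exists2 e : R, 0 < e & forall y, cdist y z < e -> U y.
Proof.
move=> /nbhs_ballP [[e1 e2]]; rewrite /= ltcE /= => /andP[/eqP -> e0] eU.
exists e1 => // y yz; apply: eU; rewrite /ball /= -opprB normrN.
by rewrite ltcE /= eqxx.
Qed.

(** * Triangles at an interior vertex *)

Lemma positively_orientedE (R : realType) (a b c : Cplx R) :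
  positively_oriented a b c = (0 < orient a b c).
Proof. by []. Qed.

Lemma fset3_rot (V : choiceType) (a b c : V) :
  [fset b; c; a]%fset = [fset a; b; c]%fset.
Proof.
apply/fsetP => x; rewrite !inE.
by case: (x == a); case: (x == b); case: (x == c).
Qed.

Lemma fset3C (V : choiceType) (a b c : V) :
  [fset a; c; b]%fset = [fset a; b; c]%fset.
Proof.
apply/fsetP => x; rewrite !inE.
by case: (x == a); case: (x == b); case: (x == c).
Qed.

Lemma uniq3_rot (V : eqType) (a b c : V) :
  uniq [:: a; b; c] -> uniq [:: b; c; a].
Proof. by move=> abc; rewrite -(rot_uniq 1) in abc. Qed.

Lemma positive_face_rot (R : realType) (V : choiceType)
    (K : planar_complex R V) a b c :
  positive_face K a b c -> positive_face K b c a.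
Proof.
move=> [[abc sK] pos]; split.
  by split; [exact: uniq3_rot | rewrite fset3_rot].
by rewrite positively_orientedE orient_rot.
Qed.

Lemma faceC (R : realType) (V : choiceType) (K : planar_complex R V) a b c :
  face K a b c -> face K a c b.
Proof.
move=> [abc sK]; split; last by rewrite fset3C.
by move: abc; rewrite /= !inE [c == b]eq_sym orbC.
Qed.

Lemma orientC (R : realType) (a b c : Cplx R) : orient a c b = - orient a b c.
Proof.
by case: a b c => [a1 a2] [b1 b2] [c1 c2]; rewrite /orient /cross /=; ring.
Qed.

(** If the sides [b - a] and [c - a] are parallel, their real parts, or their
imaginary parts, are the coefficients of an affine dependence. *)
Lemma face_orient_neq0 (R : realType) (V : choiceType)
    (K : planar_complex R V) a b c : simplicial_2_complex K -> face K a b c ->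
  orient (position K a) (position K b) (position K c) != 0.
Proof.
move=> hK [abc sK]; apply/eqP.
have := simplicial_affine hK sK.
move: (abc); rewrite /= !inE negb_or !andbT => /andP[/andP[ab ac] bc].
have [ab' ac' bc'] : [/\ (b == a) = false, (c == a) = false & (c == b) = false].
  by split; rewrite eq_sym; exact: negPf.
have ina : a \in [fset a; b; c]%fset by rewrite !inE eqxx.
have inb : b \in [fset a; b; c]%fset by rewrite !inE eqxx orbT.
have inc : c \in [fset a; b; c]%fset by rewrite !inE eqxx orbT.
move=> aff.
have {ina inb inc} aff : forall be ga : R,
    (- be - ga)%:C%C * position K a + be%:C%C * position K b
      + ga%:C%C * position K c = 0 -> be = 0 /\ ga = 0.
  move=> be ga h.
  have := aff (fun x =>
    if x == a then - be - ga else if x == b then be else ga).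
  rewrite !big_fset3 // !eqxx ab' ac' bc' => /(_ _ h) aff'.
  split.
    by have := aff' _ b inb; rewrite ab' eqxx; apply; ring.
  by have := aff' _ c inc; rewrite ac' bc'; apply; ring.
rewrite /orient /cross; move: aff.
case: (position K a) => [a1 a2]; case: (position K b) => [b1 b2].
case: (position K c) => [c1 c2] /= aff nul.
have [h1 h2] : c1 - a1 = 0 /\ - (b1 - a1) = 0.
  by apply: aff; congr (_ +i* _)%C; [ring | rewrite /=; lra].
have [h3 h4] : c2 - a2 = 0 /\ - (b2 - a2) = 0.
  by apply: aff; congr (_ +i* _)%C; [rewrite /=; lra | ring].
have [/eqP] : (1 : R) = 0 /\ (0 : R) = 0.
  by apply: aff; congr (_ +i* _)%C; rewrite /=; lra.
by rewrite oner_eq0.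
Qed.

Lemma face_positive (R : realType) (V : choiceType)
    (K : planar_complex R V) a b c : simplicial_2_complex K -> face K a b c ->
  positive_face K a b c \/ positive_face K a c b.
Proof.
move=> hK f; have := face_orient_neq0 hK f.
rewrite neq_lt => /orP[neg|pos]; last by left.
right; split; first exact: faceC.
by rewrite positively_orientedE orientC oppr_gt0.
Qed.

(** [P] holds at times [t > 0] tending to [0]. *)
Definition near0_often (R : realType) (P : R -> Prop) : Prop :=
  forall e, 0 < e -> exists2 t, 0 < t < e & P t.

Lemma near0_often_pigeonhole (R : realType) (T : eqType) (s : seq T)
    (Q : T -> R -> Prop) (e0 : R) : 0 < e0 ->
  (forall t, 0 < t < e0 -> exists2 x, x \in s & Q x t) ->
  exists2 x, x \in s & near0_often (Q x).
Proof.
elim: s e0 => [|x s IH] e0 e0_gt0 cov.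
  by have [|y] := cov (e0 / 2); first lra.
have [often|] := pselect (near0_often (Q x)).
  by exists x; rewrite ?mem_head.
move/existsNP => [e /not_implyP[e_gt0 rare]].
have [||y ys Qy] := IH (Num.min e0 e).
- by rewrite lt_min e0_gt0.
- move=> t; rewrite lt_min => /andP[t0 /andP[te0 te]].
  have [|y] := cov t; first by rewrite t0.
  rewrite inE => /orP[/eqP -> Qt|ys Qt]; last by exists y.
  by case: rare; exists t; rewrite ?t0.
- by exists y; rewrite // inE ys orbT.
Qed.

Definition parabola (R : realType) (z d e : Cplx R) (t : R) : Cplx R :=
  z + t%:C%C * d + (t ^+ 2)%:C%C * e.

Lemma orient_parabola (R : realType) (a b z d e : Cplx R) (t : R) :
  orient a b (parabola z d e t) =
  orient a b z + cross (b - a) d * t + cross (b - a) e * t ^+ 2.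
Proof.
case: a b z d e => [a1 a2] [b1 b2] [z1 z2] [d1 d2] [e1 e2].
by rewrite /orient /cross /=; ring.
Qed.

Lemma orient_line (R : realType) (a b z d : Cplx R) (t : R) :
  orient a b (z + t%:C%C * d) = orient a b z + cross (b - a) d * t.
Proof.
case: a b z d => [a1 a2] [b1 b2] [z1 z2] [d1 d2].
by rewrite /orient /cross /=; ring.
Qed.

Lemma parabola_near (R : realType) (z d e : Cplx R) (r : R) : 0 < r ->
  exists2 h, 0 < h & forall t, 0 < t < h -> cdist (parabola z d e t) z < r.
Proof.
move=> r0; set D := ComplexField.Normc.normc d.
set E := ComplexField.Normc.normc e.
have D0 : 0 <= D by rewrite /D; case: (d) => ? ?; exact: sqrtr_ge0.
have E0 : 0 <= E by rewrite /E; case: (e) => ? ?; exact: sqrtr_ge0.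
exists (Num.min 1 (r / (D + E + 1))).
  by rewrite lt_min ltr01 divr_gt0 //; lra.
move=> t; rewrite lt_min => /andP[t0 /andP[t1]]; rewrite ltr_pdivlMr; last lra.
move=> tr; rewrite /cdist.
have -> : parabola z d e t - z = t%:C%C * d + (t ^+ 2)%:C%C * e.
  by rewrite /parabola -!addrA addrC -!addrA addNr addr0.
have nt (x : R) : ComplexField.Normc.normc (x%:C)%C = `|x|.
  by rewrite /= expr0n addr0 sqrtr_sqr.
apply: le_lt_trans (le_normcD _ _) _.
rewrite !ComplexField.Normc.normcM !nt -/D -/E !ger0_norm ?sqr_ge0 ?(ltW t0) //.
have : t ^+ 2 * E <= t * E by rewrite ler_wpM2r // expr2 ger_pMr // ltW.
by lra.
Qed.

(** Three points of a nondegenerate parabola are never collinear: their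
orientation is a Vandermonde determinant times [cross d e]. *)
Lemma parabola_not_in_line (R : realType) (z d e a w : Cplx R) :
  cross d e != 0 ->
  ~ near0_often (fun t => exists m : R, parabola z d e t = a + m%:C%C * w).
Proof.
move=> nz often.
have [t1 /andP[t1_gt0 _] [m1 e1]] := often 1 ltr01.
have [t2 /andP[t2_gt0 t21] [m2 e2]] := often t1 t1_gt0.
have [t3 /andP[t3_gt0 t32] [m3 e3]] := often t2 t2_gt0.
have : orient (parabola z d e t1) (parabola z d e t2) (parabola z d e t3) = 0.
  rewrite e1 e2 e3; case: (a) (w) => [? ?] [? ?].
  by rewrite /orient /cross /=; ring.
have -> : orient (parabola z d e t1) (parabola z d e t2) (parabola z d e t3) =
    (t1 - t2) * (t2 - t3) * (t1 - t3) * - cross d e.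
  case: (z) (d) (e) => [? ?] [? ?] [? ?].
  by rewrite /orient /cross /=; ring.
apply/eqP; rewrite !mulf_neq0 ?oppr_eq0 // subr_eq0 gt_eqF //.
exact: lt_trans t21.
Qed.

Lemma fset_card_le3 (V : choiceType) (s : {fset V}) : (0 < #|` s| <= 3)%N ->
  (exists a b, s = [fset a; b]%fset) \/
  (exists a b c, uniq [:: a; b; c] /\ s = [fset a; b; c]%fset).
Proof.
have: uniq (enum_fset s) by exact: fset_uniq.
have: forall x, (x \in s) = (x \in enum_fset s) by [].
case: (enum_fset s) => [|a [|b [|c [|? ?]]]] // mem_s us _.
- by left; exists a, a; apply/fsetP => x; rewrite mem_s !inE orbb.
- by left; exists a, b; apply/fsetP => x; rewrite mem_s !inE.
- right; exists a, b, c; split=> //.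
  by apply/fsetP => x; rewrite mem_s !inE orbA.
Qed.

(** By local finiteness one simplex contains the parabola at times tending to
[0].  It is a triangle, since the parabola meets every line at most twice; by
[quadratic_germ] this triangle contains a segment from [v] in the direction [d]
tangent to the parabola. *)
Lemma interior_germ (R : realType) (V : choiceType) (K : planar_complex R V)
    v d e : disc_triangulation K -> interior_vertex K v -> cross d e != 0 ->
  exists a b c, [/\ positive_face K a b c,
    exists2 h, 0 < h & forall t, 0 <= t < h ->
      hull K [fset a; b; c]%fset (position K v + t%:C%C * d) &
    exists2 t, 0 < t &
      hull K [fset a; b; c]%fset (parabola (position K v) d e t)].
Proof.
move=> [hK lf _] iv de.
have [|U nU] := lf (position K v); first exact: nbhs_singleton iv.
move=> /finite_seqP[S SE].
have [r r0 rU] := nbhs_cdist (filterI iv nU).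
have [h h0 hr] := parabola_near (position K v) d e r0.
have [|s _ often] := @near0_often_pigeonhole R _ S
    (fun s t => simplex K s /\ hull K s (parabola (position K v) d e t)) h h0.
  move=> t /hr /rU[[s sK st] Ut]; exists s => //.
  have : [set` S] s; last by [].
  by rewrite -SE; split=> //; exists (parabola (position K v) d e t).
have [t0 _ [sK _]] := often 1 ltr01.
have [[a [b sE]]|[a [b [c [abc sE]]]]] := fset_card_le3 (simplicial_dim hK sK).
  exfalso; apply: (@parabola_not_in_line _ (position K v) d e (position K a)
    (position K b - position K a) de) => x /often[t xt [_]].
  by rewrite sE => /hull_fset2[m _ em]; exists t => //; exists m.
wlog pos : b c abc sE / positive_face K a b c.
  move=> wl; have f : face K a b c by split; rewrite -?sE.
  have [pos|pos] := face_positive hK f; first exact: wl sE pos.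
  by apply: (wl c b _ _ pos); [case: pos => -[] | rewrite fset3C].
exists a, b, c; have [_ or] := pos.
have oft : near0_often (fun t => hull K [fset a; b; c]%fset
    (parabola (position K v) d e t)).
  by move=> x /often[t xt [_ ht]]; exists t; rewrite // -sE.
split => //; last by have [t /andP[t_gt0 _] ht] := oft 1 ltr01; exists t.
have [|h1 h1_gt0 hull1] := @quadratic_germ R
    (orient (position K a) (position K b) (position K v))
    (cross (position K b - position K a) d)
    (cross (position K b - position K a) e).
  move=> x /oft[t xt /(hull_fset3 _ abc or)[+ _ _]].
  by rewrite orient_parabola; exists t.
have [|h2 h2_gt0 hull2] := @quadratic_germ R
    (orient (position K b) (position K c) (position K v))
    (cross (position K c - position K b) d)
    (cross (position K c - position K b) e).
  move=> x /oft[t xt /(hull_fset3 _ abc or)[_ + _]].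
  by rewrite orient_parabola; exists t.
have [|h3 h3_gt0 hull3] := @quadratic_germ R
    (orient (position K c) (position K a) (position K v))
    (cross (position K a - position K c) d)
    (cross (position K a - position K c) e).
  move=> x /oft[t xt /(hull_fset3 _ abc or)[_ _ +]].
  by rewrite orient_parabola; exists t.
exists (Num.min h1 (Num.min h2 h3)); first by rewrite !lt_min h1_gt0 h2_gt0.
move=> t; rewrite !lt_min => /andP[t_ge0 /and3P[t1 t2 t3]].
by apply/(hull_fset3 _ abc or); rewrite !orient_line; split;
  [apply: hull1|apply: hull2|apply: hull3]; rewrite t_ge0.
Qed.

(** * The two faces at an edge *)

Lemma face_positive_asym (R : realType) (V : choiceType)
    (K : planar_complex R V) a b c :
  positive_face K a b c -> ~ positive_face K a c b.
Proof.
move=> [_]; rewrite positively_orientedE => pos [_].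
by rewrite positively_orientedE orientC oppr_gt0 ltNge ltW.
Qed.

(** The hulls of [[fset v]] and [s] meet, so they share the vertex [v]. *)
Lemma vertex_of_hull (R : realType) (V : choiceType) (K : planar_complex R V)
    s v : simplicial_2_complex K -> simplex K s -> hull K s (position K v) ->
  v \in s.
Proof.
move=> hK sK vs; apply/negPn/negP => v_notin.
apply: (@hull_fset0 _ _ K (position K v)).
rewrite -(_ : [fset v] `&` s = fset0)%fset; last first.
  by apply/fsetP => x; rewrite !inE; case: eqP => // ->; exact: negPf.
rewrite -(simplicial_meet hK) //; last exact: simplicial_vertex.
by split=> //; exact/hull_fset1.
Qed.

Lemma position_inj (R : realType) (V : choiceType) (K : planar_complex R V) :
  simplicial_2_complex K -> injective (position K).
Proof.
move=> hK u v uv; apply/fset1P; apply: (vertex_of_hull hK).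
  exact: simplicial_vertex.
exact/hull_fset1.
Qed.

(** A simplex that contains an inner point of the edge [vu] meets it in a face
of that edge which is not a vertex. *)
Lemma edge_of_hull (R : realType) (V : choiceType) (K : planar_complex R V)
    s v u t : simplicial_2_complex K -> simplex K s -> adjacent K v u ->
  v \in s -> 0 < t < 1 ->
  hull K s (position K v + t%:C%C * (position K u - position K v)) -> u \in s.
Proof.
move=> hK sK [vu eK] vs /andP[t0 t1] hz; apply/negPn/negP => u_notin.
have uv : (u == v) = false by rewrite eq_sym; exact: negPf.
set z := _ + _ in hz.
have /hull_fset1 : hull K [fset v]%fset z.
  rewrite -(_ : [fset v; u] `&` s = [fset v])%fset; last first.
    apply/fsetP => x; rewrite !inE; case: (eqVneq x v) => [->|_] //=.
    by case: eqP => // ->; exact: negPf.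
  rewrite -(simplicial_meet hK) //; split=> //.
  exists (fun x => if x == v then 1 - t else t).
  rewrite !big_fset2 // eqxx uv; split.
  - by move=> x _; case: ifP => _; lra.
  - by rewrite subrK.
  - by rewrite /z rmorphB rmorph1; ring.
move/eqP; rewrite -subr_eq0 /z addrAC subrr add0r mulf_eq0 subr_eq0.
rewrite (inj_eq (position_inj hK)) uv orbF eq_complex /= eqxx andbT.
by rewrite gt_eqF.
Qed.

(** The triangle of [interior_germ] contains [v], which is therefore one of its
vertices and can be listed first. *)
Lemma interior_germ_at (R : realType) (V : choiceType) (K : planar_complex R V)
    v d e : disc_triangulation K -> interior_vertex K v -> cross d e != 0 ->
  exists b c, [/\ positive_face K v b c,
    exists2 h, 0 < h & forall t, 0 <= t < h ->
      hull K [fset v; b; c]%fset (position K v + t%:C%C * d) &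
    exists2 t, 0 < t &
      hull K [fset v; b; c]%fset (parabola (position K v) d e t)].
Proof.
move=> tK iv de; have [hK _ _] := tK.
have [a [b [c [pos line par]]]] := interior_germ tK iv de.
have : v \in [fset a; b; c]%fset.
  have [[_ sK] _] := pos; apply: (vertex_of_hull hK sK).
  have [h h0 /(_ 0)] := line; rewrite mul0r addr0; apply.
  by rewrite lexx.
rewrite !inE -orbA => /or3P[] /eqP vE; subst v.
- by exists b, c.
- exists c, a; split; first exact: positive_face_rot.
    by rewrite fset3_rot.
  by rewrite fset3_rot.
- exists a, b; split; first by do 2 apply: positive_face_rot.
    by rewrite -fset3_rot.
  by rewrite -fset3_rot.
Qed.

(** Multiplication by [i], in coordinates. *)
Definition rot90 (R : realType) (d : Cplx R) : Cplx R := (- Im d +i* Re d)%C.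

Lemma cross_rot90 (R : realType) (d : Cplx R) :
  cross d (rot90 d) = Re d ^+ 2 + Im d ^+ 2.
Proof. by rewrite /cross /=; ring. Qed.

Lemma cross_rot90_gt0 (R : realType) (d : Cplx R) : d != 0 ->
  0 < cross d (rot90 d).
Proof.
move=> d0; rewrite cross_rot90 lt0r addr_ge0 ?sqr_ge0 // andbT.
rewrite paddr_eq0 ?sqr_ge0 // !sqrf_eq0.
by apply: contraNN d0 => h; rewrite eq_complex.
Qed.

Lemma orient_chord_parabola (R : realType) (z u e : Cplx R) (t : R) :
  orient z u (parabola z (u - z) e t) = cross (u - z) e * t ^+ 2.
Proof.
rewrite orient_parabola; case: z u e => [? ?] [? ?] [? ?].
by rewrite /orient /cross /=; ring.
Qed.

(** Applied with the direction [d = u - v], the triangle of [interior_germ_at]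
contains an initial part of the edge [vu], so it is a face with that edge; the
point of the parabola in it shows on which side it lies. *)
Lemma side_face (R : realType) (V : choiceType) (K : planar_complex R V)
    v u e : disc_triangulation K -> interior_vertex K v -> adjacent K v u ->
  cross (position K u - position K v) e != 0 ->
  exists w, (0 < cross (position K u - position K v) e /\ positive_face K v u w)
    \/ (cross (position K u - position K v) e < 0 /\ positive_face K v w u).
Proof.
move=> tK iv vu nz; have [hK _ _] := tK.
have [b [c [pos [h h0 line] [t t0 par]]]] := interior_germ_at tK iv nz.
have [[vbc sK] or] := pos.
have : u \in [fset v; b; c]%fset.
  apply: (@edge_of_hull _ _ K _ v u (Num.min h 1 / 2) hK sK vu).
  - by rewrite !inE eqxx.
  - have : 0 < Num.min h 1 by rewrite lt_min h0 ltr01.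
    have : Num.min h 1 <= 1 by rewrite ge_min lexx orbT.
    by move=> *; lra.
  - apply: line; have : 0 < Num.min h 1 by rewrite lt_min h0 ltr01.
    have : Num.min h 1 <= h by rewrite ge_min lexx.
    by move=> *; lra.
have vuE : (u == v) = false by have [/negPf] := vu; rewrite eq_sym.
have t2 : 0 < t ^+ 2 by rewrite exprn_gt0.
move/(hull_fset3 _ vbc or): par => [hvb _ hcv].
rewrite !inE vuE /= => /orP[] /eqP uE; subst u.
- exists c; left; split=> //; move: hvb.
  by rewrite orient_chord_parabola pmulr_lge0 // le_eqVlt eq_sym (negPf nz).
- exists b; right; split=> //; move: hcv.
  rewrite -orient_rot orientC orient_chord_parabola oppr_ge0 pmulr_lle0 //.
  by rewrite le_eqVlt (negPf nz).
Qed.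

Lemma side_faces_exist (R : realType) (V : choiceType)
    (K : planar_complex R V) v u : disc_triangulation K ->
  interior_vertex K v -> adjacent K v u ->
  (exists w, positive_face K v u w) /\ (exists w, positive_face K v w u).
Proof.
move=> tK iv vu; have [hK _ _] := tK.
set d := position K u - position K v.
have : 0 < cross d (rot90 d).
  apply: cross_rot90_gt0; rewrite subr_eq0 (inj_eq (position_inj hK)) eq_sym.
  by case: vu.
move=> d0; split.
  have [w [[_]|[]]] := side_face tK iv vu (lt0r_neq0 d0); first by exists w.
  by rewrite ltNge ltW.
have crossN : cross d (- rot90 d) = - cross d (rot90 d).
  by rewrite /cross /=; ring.
have [|w [[]|[_]]] := @side_face _ _ K v u (- rot90 d) tK iv vu.
- by rewrite crossN oppr_eq0 lt0r_neq0.
- by rewrite crossN oppr_gt0 ltNge ltW.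
- by exists w.
Qed.

Lemma orient_chord (R : realType) (a b : Cplx R) (m : R) :
  orient a b (a + m%:C%C * (b - a)) = 0.
Proof.
by case: a b => [? ?] [? ?]; rewrite /orient /cross /=; ring.
Qed.

Lemma orient_chord_rot90 (R : realType) (a b : Cplx R) (t : R) :
  orient a b (a + (2^-1)%:C%C * (b - a) + t%:C%C * rot90 (b - a)) =
  cross (b - a) (rot90 (b - a)) * t.
Proof.
by case: a b => [? ?] [? ?]; rewrite /orient /cross /=; field.
Qed.

(** At the midpoint of the edge [vu] the other two inequalities of the triangle
are strict, so a short perpendicular segment to its left stays inside. *)
Lemma left_face_covers (R : realType) (V : choiceType)
    (K : planar_complex R V) v u w
    (d := position K u - position K v) : positive_face K v u w ->
  exists2 h, 0 < h & forall t, 0 < t < h -> hull K [fset v; u; w]%fset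
    (position K v + (2^-1)%:C%C * d + t%:C%C * rot90 d).
Proof.
move=> [[vuw sK] or]; set A := position K v in or d *.
set B := position K u in or d *; set C := position K w in or *.
have [h1 h1_gt0 near1] := @affine_germ R (orient A B C / 2)
  (cross (C - B) (rot90 d)) (divr_gt0 or (ltr0n _ 2)).
have [h2 h2_gt0 near2] := @affine_germ R (orient A B C / 2)
  (cross (A - C) (rot90 d)) (divr_gt0 or (ltr0n _ 2)).
exists (Num.min h1 h2) => [|t]; first by rewrite lt_min h1_gt0.
rewrite lt_min => /andP[t0 /andP[t1 t2]].
have t_ge0 := ltW t0; set z := _ + _.
have zAB : orient A B z = cross d (rot90 d) * t.
  exact: orient_chord_rot90.
have zBC : orient B C z = orient A B C / 2 + cross (C - B) (rot90 d) * t.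
  rewrite /z /d /orient /cross.
  by case: (A) (B) (C) => [? ?] [? ?] [? ?] /=; field.
have zCA : orient C A z = orient A B C / 2 + cross (A - C) (rot90 d) * t.
  rewrite /z /d /orient /cross.
  by case: (A) (B) (C) => [? ?] [? ?] [? ?] /=; field.
apply/(hull_fset3 _ vuw or); rewrite -/A -/B -/C zAB zBC zCA; split.
- by rewrite mulr_ge0 // cross_rot90 addr_ge0 ?sqr_ge0.
- by apply: near1; rewrite t_ge0.
- by apply: near2; rewrite t_ge0.
Qed.

(** Two such faces would share points off the edge [vu], whereas the meet of
their hulls is the hull of their common vertices. *)
Lemma left_face_unique (R : realType) (V : choiceType)
    (K : planar_complex R V) v u w w' : simplicial_2_complex K ->
  positive_face K v u w -> positive_face K v u w' -> w = w'.
Proof.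
move=> hK fw fw'; apply/eqP/negPn/negP => ww'.
have [h h0 cov] := left_face_covers fw.
have [h' h0' cov'] := left_face_covers fw'.
have [[vuw sK] _] := fw; have [[vuw' sK'] _] := fw'.
have m0 : 0 < Num.min h h' by rewrite lt_min h0.
have t0 : 0 < Num.min h h' / 2 by lra.
have {cov}/cov hz : 0 < Num.min h h' / 2 < h.
  have : Num.min h h' <= h by rewrite ge_min lexx.
  by move=> *; lra.
have {cov'}/cov' hz' : 0 < Num.min h h' / 2 < h'.
  have : Num.min h h' <= h' by rewrite ge_min lexx orbT.
  by move=> *; lra.
move: t0 hz hz'; set t := _ / 2; set d := position K u - position K v.
move=> t0 hz hz'.
have : hull K ([fset v; u; w] `&` [fset v; u; w'])%fset
    (position K v + (2^-1)%:C%C * d + t%:C%C * rot90 d).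
  by rewrite -(simplicial_meet hK).
have -> : ([fset v; u; w] `&` [fset v; u; w'] = [fset v; u])%fset.
  apply/fsetP => x; rewrite !inE; case: (x == v) => //=; case: (x == u) => //=.
  by case: eqP => // ->; exact: negPf.
case/hull_fset2 => m _; rewrite -/d => zE.
have d0 : d != 0.
  rewrite subr_eq0 (inj_eq (position_inj hK)); move: vuw.
  by rewrite /= !inE negb_or eq_sym => /andP[/andP[]].
have := orient_chord_rot90 (position K v) (position K u) t.
rewrite zE orient_chord.
move/esym => h1.
by have := mulr_gt0 (cross_rot90_gt0 d0) t0; rewrite h1 ltxx.
Qed.

(** A face on the right of [vu] is on the left of [uv]. *)
Lemma right_face_unique (R : realType) (V : choiceType)
    (K : planar_complex R V) v u w w' : simplicial_2_complex K ->
  positive_face K v w u -> positive_face K v w' u -> w = w'.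
Proof.
move=> hK fw fw'; apply: (@left_face_unique _ _ K u v w w' hK);
  by do 2 apply: positive_face_rot.
Qed.

Lemma face_adjacent (R : realType) (V : choiceType)
    (K : planar_complex R V) v u w : simplicial_2_complex K ->
  face K v u w -> [/\ adjacent K v u, adjacent K v w & adjacent K u w].
Proof.
move=> hK [+ sK]; rewrite /= !inE negb_or !andbT => /andP[/andP[vu vw] uw].
split; split=> //; apply: (simplicial_sub hK sK).
- by apply/fsubsetP => x; rewrite !inE => ->.
- by apply/fset0Pn; exists v; rewrite !inE eqxx.
- by apply/fsubsetP => x; rewrite !inE -orbA orbCA => ->; rewrite orbT.
- by apply/fset0Pn; exists v; rewrite !inE eqxx.
- by apply/fsubsetP => x; rewrite !inE -orbA => ->; rewrite orbT.
- by apply/fset0Pn; exists u; rewrite !inE eqxx.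
Qed.

(** Every simplex having [v] as a vertex meets every neighbourhood of [v]. *)
Lemma star_finite (R : realType) (V : choiceType) (K : planar_complex R V) v :
  locally_finite_complex K -> interior_vertex K v ->
  exists2 A : seq V, uniq A &
    forall s x, simplex K s -> v \in s -> x \in s -> x \in A.
Proof.
move=> lf iv; have [|U nU] := lf (position K v); first exact: nbhs_singleton iv.
move=> /finite_seqP[S SE]; exists (undup (flatten (map (@enum_fset V) S))).
  exact: undup_uniq.
move=> s x sK vs xs; rewrite mem_undup; apply/flattenP.
exists (enum_fset s) => //; apply: map_f.
have : [set` S] s; last by [].
rewrite -SE; split=> //; exists (position K v).
split; last exact: nbhs_singleton.
exists (fun y => (y == v)%:R); split.
- by move=> y _; rewrite ler0n.
- rewrite (bigD1_seq v) //= ?fset_uniq // eqxx big1 ?addr0 // => y /negPf ->.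
  by [].
- rewrite (bigD1_seq v) //= ?fset_uniq // eqxx big1 ?mul1r ?addr0 //.
  by move=> y /negPf ->; rewrite mul0r.
Qed.

(** * Summation around a vertex *)

Lemma fsbig_sub_seq (R : nmodType) (V : choiceType) (A : seq V) (D : set V)
    (F : V -> R) : uniq A -> (forall x, D x -> x \in A) ->
  \sum_(x \in D) F x = \sum_(x <- A | x \in D) F x.
Proof.
move=> uA DA; rewrite [RHS]big_mkcond /=.
rewrite -(fsbig_fwiden A D) //.
- by apply: eq_fsbigr => x ->.
- by move=> x [_ Dx]; rewrite /= memNset.
Qed.

Lemma sum_exists_unique (R : pzSemiRingType) (V : eqType) (A : seq V)
    (P : pred V) w :
  uniq A -> w \in A -> P w -> (forall x, P x -> x = w) ->
  \sum_(x <- A) (P x)%:R = 1 :> R.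
Proof.
move=> uA wA Pw Pu; rewrite (bigD1_seq w) //= Pw big1 ?addr0 // => x xw.
by case Px : (P x) => //; rewrite (Pu x Px) eqxx in xw.
Qed.

(** Regrouping the terms by positive pair [P u w] turns the sum into that of
[k w - k u], in which every [u] in [N] occurs once with each sign. *)
Lemma cyclic_telescope (R : comPzRingType) (V : eqType) (A : seq V) (N : pred V)
    (P : rel V) (rho : V -> V -> R) (g k : V -> R) :
  (forall u, \sum_(w <- A) (P u w)%:R = (N u)%:R :> R) ->
  (forall w, \sum_(u <- A) (P u w)%:R = (N w)%:R :> R) ->
  (forall u w, rho u w = rho w u) ->
  (forall u w, P u w -> rho u w * (g u + g w) = k w - k u) ->
  \sum_(u <- A) \sum_(w <- A) ((P u w)%:R + (P w u)%:R) * (rho u w * g u) = 0.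
Proof.
move=> out inn sym bal.
transitivity (\sum_(u <- A) \sum_(w <- A) (P u w)%:R * (k w - k u)).
  transitivity (\sum_(u <- A) \sum_(w <- A) (P u w)%:R * (rho u w * g u)
      + \sum_(u <- A) \sum_(w <- A) (P u w)%:R * (rho u w * g w)).
    rewrite [X in _ + X]exchange_big /= -big_split; apply: eq_bigr => u _ /=.
    by rewrite -big_split; apply: eq_bigr => w _ /=; rewrite mulrDl (sym w u).
  rewrite -big_split; apply: eq_bigr => u _; rewrite -big_split.
  apply: eq_bigr => w _ /=; case Puw : (P u w); last by rewrite !mul0r addr0.
  by rewrite !mul1r -mulrDr bal.
transitivity (\sum_(w <- A) (N w)%:R * k w - \sum_(u <- A) (N u)%:R * k u).
  rewrite -[X in _ - X](eq_bigr _
    (fun u _ => congr1 (fun n => n * k u) (out u))).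
  rewrite -[X in X - _](eq_bigr _
    (fun u _ => congr1 (fun n => n * k u) (inn u))).
  under [X in _ - X]eq_bigr do rewrite mulr_suml.
  under [X in X - _]eq_bigr do rewrite mulr_suml.
  rewrite [X in X - _]exchange_big /= -sumrB; apply: eq_bigr => u _.
  by rewrite -sumrB; apply: eq_bigr => w _; rewrite mulrBr.
by rewrite subrr.
Qed.

Lemma packed_face_tangent (R : realType) (V : choiceType)
    (K : planar_complex R V) (P : V -> circle R) u v w :
  simplicial_2_complex K -> univalent_packing K P -> face K u v w ->
  mutually_tangent (P u) (P v) (P w).
Proof.
move=> hK [_ tangent _] /(face_adjacent hK)[uv uw vw].
by split; apply: tangent_sqdist; exact: tangent.
Qed.

Lemma face_radius_gt0 (R : realType) (V : choiceType)
    (K : planar_complex R V) (P : V -> circle R) u v w :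
  simplicial_2_complex K -> univalent_packing K P -> face K u v w ->
  0 < orthogonal_radius (P u) (P v) (P w).
Proof.
move=> hK hP.
have pos_gt0 a b c : positive_face K a b c ->
    0 < orthogonal_radius (P a) (P b) (P c).
  move=> pos; have [_ _ /(_ _ _ _ pos) or] := hP; have [f _] := pos.
  rewrite (orthogonal_radiusE (packed_face_tangent hK hP f) or).
  exact: inradius_gt0.
by case/(face_positive hK) => /pos_gt0 //; rewrite orthogonal_radiusC.
Qed.

(** The faces [vuw] of an unordered pair [u], [w] are split according to
orientation, and [cyclic_telescope] is applied to the positive pairs. *)
Lemma star_balance (R : realType) (V : choiceType)
    (K : planar_complex R V) (P : V -> circle R) v (A : seq V) (g k : V -> R) :
  disc_triangulation K -> interior_vertex K v -> uniq A ->
  (forall s x, simplex K s -> v \in s -> x \in s -> x \in A) ->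
  (forall u w, positive_face K v u w ->
    orthogonal_radius (P v) (P u) (P w) * (g u + g w) = k w - k u) ->
  \sum_(u <- A | `[< adjacent K v u >])
    \sum_(w <- A | `[< face K v u w >])
      orthogonal_radius (P v) (P u) (P w) * g u = 0.
Proof.
move=> tK iv uA starA bal; have [hK _ _] := tK.
have inA a b : positive_face K v a b -> a \in A /\ b \in A.
  by move=> [[_ sK] _]; split; apply: (starA _ _ sK); rewrite !inE eqxx ?orbT.
pose pf u w := `[< positive_face K v u w >].
have count (Q : pred V) (b : bool) : (b -> exists w, Q w) ->
    (forall w, Q w -> b) ->
    (forall w, Q w -> w \in A) -> (forall w w', Q w -> Q w' -> w = w') ->
    \sum_(w <- A) (Q w)%:R = b%:R :> R.
  move=> ex bQ QA Q1; case: b ex bQ => [/(_ isT)[w Qw] _|_ bQ].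
    by rewrite (@sum_exists_unique R _ _ _ w) ?QA // => x Qx; exact: Q1.
  by rewrite big1 // => w _; case Qw : (Q w) => //; have := bQ w Qw.
rewrite -[RHS](@cyclic_telescope R V A (fun u => `[< adjacent K v u >]) pf
  (fun u w => orthogonal_radius (P v) (P u) (P w)) g k).
- rewrite big_mkcond; apply: eq_bigr => u _; case: asboolP => vu.
    rewrite big_mkcond; apply: eq_bigr => w _; rewrite /pf.
    case: asboolP => [f|nf].
      have [pos|pos] := face_positive hK f.
        rewrite asboolT // asboolF ?addr0 ?mul1r // => neg.
        by have := face_positive_asym pos neg.
      rewrite [in X in _ = (_ + X) * _]asboolT //
        asboolF ?add0r ?mul1r // => neg.
      by have := face_positive_asym pos neg.
    rewrite asboolF; last by case=> f; case: nf.
    rewrite asboolF; last by case=> /faceC f; case: nf.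
    by rewrite addr0 mul0r.
  rewrite big1 // => w _; rewrite /pf asboolF; last first.
    by case=> f; have [] := face_adjacent hK f.
  rewrite asboolF; last by case=> f; have [] := face_adjacent hK f.
  by rewrite addr0 mul0r.
- move=> u; apply: count.
  + move/asboolP => vu; have [[w pos] _] := side_faces_exist tK iv vu.
    by exists w; exact/asboolP.
  + by move=> w /asboolP[f _]; apply/asboolP; have [] := face_adjacent hK f.
  + by move=> w /asboolP/inA[].
  + by move=> w w' /asboolP h /asboolP h'; exact: left_face_unique hK h h'.
- move=> u; apply: count.
  + move/asboolP => vu; have [_ [w pos]] := side_faces_exist tK iv vu.
    by exists w; exact/asboolP.
  + by move=> w /asboolP[f _]; apply/asboolP; have [] := face_adjacent hK f.
  + by move=> w /asboolP/inA[].
  + by move=> w w' /asboolP h /asboolP h'; exact: right_face_unique hK h h'.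
- by move=> u w; exact: orthogonal_radiusC.
- by move=> u w /asboolP; exact: bal.
Qed.

(** After multiplication by the total conductance, which is positive because an
interior vertex lies on some face, harmonicity is the vanishing of the sum over
[u] of [conductance v u * (f u - f v)]. *)
Lemma balanced_harmonic (R : realType) (V : choiceType)
    (K : planar_complex R V) (P : V -> circle R) (f : V -> R)
    (k : V -> V -> R) : disc_triangulation K -> univalent_packing K P ->
  (forall v u w, positive_face K v u w ->
    orthogonal_radius (P v) (P u) (P w)
      * ((f u - f v) / (radius (P v) + radius (P u))
        + (f w - f v) / (radius (P v) + radius (P w))) = k v w - k v u) ->
  harmonic_function K (transition K P) f.
Proof.
move=> tK hP bal v iv; have [hK lf _] := tK.
have [A uA starA] := star_finite lf iv.
have adjA u : adjacent K v u -> u \in A.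
  by move=> [_ sK]; apply: (starA _ _ sK); rewrite !inE eqxx ?orbT.
have faceA u w : face K v u w -> w \in A.
  by move=> [_ sK]; apply: (starA _ _ sK); rewrite !inE eqxx ?orbT.
have cE u : conductance K P v u =
    \sum_(w <- A | `[< face K v u w >]) orthogonal_radius (P v) (P u) (P w)
    / (radius (P v) + radius (P u)).
  by rewrite /conductance (fsbig_sub_seq _ uA (faceA u)) mulr_suml.
have c_ge0 u : 0 <= conductance K P v u.
  rewrite cE sumr_ge0 // => w /asboolP fw; rewrite divr_ge0 //.
    by rewrite ltW //; exact: face_radius_gt0 hK hP fw.
  by rewrite addr_ge0 // ltW // radius_gt0.
set c := \sum_(w \in [set w | adjacent K v w]) conductance K P v w.
have cA : c = \sum_(u <- A | `[< adjacent K v u >]) conductance K P v u.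
  exact: fsbig_sub_seq.
have c_neq0 : c != 0.
  (* any two independent directions produce a face at v *)
  have nz : cross (1 +i* 0 : Cplx R)%C (0 +i* 1)%C != 0.
    by rewrite /cross /= mulr1 mul0r subr0 oner_neq0.
  have [b [d [[fb _] _ _]]] := interior_germ_at tK iv nz.
  have [vb _ _] := face_adjacent hK fb.
  have r_gt0 : 0 < radius (P v) + radius (P b) by rewrite addr_gt0 ?radius_gt0.
  rewrite lt0r_neq0 // cA (big_rem b) /= ?adjA // asboolT //.
  rewrite ltr_pwDl ?sumr_ge0 // cE (big_rem d) /= ?(faceA b) // asboolT //.
  rewrite ltr_pwDl ?divr_gt0 //; first exact: face_radius_gt0 hK hP fb.
  rewrite sumr_ge0 // => w /asboolP fw; rewrite divr_ge0 ?(ltW r_gt0) //.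
  by rewrite ltW //; exact: face_radius_gt0 hK hP fw.
rewrite (fsbig_sub_seq _ uA adjA).
have zero : \sum_(u <- A | `[< adjacent K v u >])
    conductance K P v u * (f u - f v) = 0.
  rewrite -[RHS](star_balance tK iv uA starA (bal v)).
  apply: eq_bigr => u _; rewrite cE mulr_suml; apply: eq_bigr => w _.
  by rewrite mulrAC mulrA.
transitivity ((\sum_(u <- A | `[< adjacent K v u >])
    conductance K P v u * f u) / c).
  apply: (mulIf c_neq0); rewrite divfK // cA mulr_sumr.
  apply/eqP; rewrite eq_sym -subr_eq0 -sumrB -[X in _ == X]zero; apply/eqP.
  by apply: eq_bigr => u _; ring.
rewrite mulr_suml; apply: eq_bigr => u /asboolP vu.
by rewrite /transition asboolT // asboolT // -/c mulrAC.
Qed.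

Theorem lemma3p3 (R : realType) (V : choiceType) (K : planar_complex R V)
    (P : V -> circle R) (hK : disc_triangulation K)
    (hP : univalent_packing K P) :
  harmonic_function K (transition K P) (fun v => complex.Re (center (P v))) /\
  harmonic_function K (transition K P) (fun v => complex.Im (center (P v))).
Proof.
have [sK _ _] := hK; have [_ _ orP] := hP.
split.
- apply: (balanced_harmonic (k := fun v u => radius (P v) *
    ((Im (center (P u)) - Im (center (P v))) / (radius (P v) + radius (P u))))
    hK hP) => v u w pos.
  have tg := packed_face_tangent sK hP (proj1 pos).
  rewrite orthogonal_radiusE ?(proj1 (inradius_balance tg)) ?mulrBr //.
  exact: orP.
- apply: (balanced_harmonic (k := fun v u => - radius (P v) *
    ((Re (center (P u)) - Re (center (P v))) / (radius (P v) + radius (P u))))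
    hK hP) => v u w pos.
  have tg := packed_face_tangent sK hP (proj1 pos).
  rewrite orthogonal_radiusE ?(proj2 (inradius_balance tg)) ?mulrBr //.
  exact: orP.
Qed.
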